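(* Let $T>0$ and $N\in\mathbb N$. If $a,\widehat a\in X$, then there exists a constant $C>0$ depending on $T$, $a$, and $x^{[a]}(0)$ such that $$\operatorname{dist}_{\mathcal H}\bigl(x^{[a]}(t),x^{[\widehat a]}(t)\bigr)^2=\|x^{[a]}(t)-x^{[\widehat a]}(t)\|^2\le C\,\mathcal E^{[a],N}(\widehat a)\qquad\text{for all }t\in[0,T],$$ where $x^{[a]}$ and $x^{[\widehat a]}:[0,T]\to\mathbb R^{d\times N}$ are the solutions of the particle system for the interaction kernels $a$ and $\widehat a$ respectively, with the same initial datum $x^{[a]}(0)=x^{[\widehat a]}(0)$.
   Context: $\mathbb R_+=[0,\infty)$. The set of admissible kernels is $X=\{b:\mathbb R_+\to\mathbb R \mid b\in L_\infty(\mathbb R_+)\cap W^1_{\infty,\mathrm{loc}}(\mathbb R_+)\}$ (bounded functions that are Lipschitz on compact subsets of $\mathbb R_+$). Particle system with kernel $b\in X$: $x^{[b]}=(x_1^{[b]},\dots,x_N^{[b]})\in\mathbb R^{d\times N}$ solves $$\dot x_i^{[b]}(t)=\frac1N\sum_{j\ne i}b(|x_i^{[b]}(t)-x_j^{[b]}(t)|)\,(x_j^{[b]}(t)-x_i^{[b]}(t)),\qquad i=1,\dots,N,$$ where $|\cdot|$ is the Euclidean norm on $\mathbb R^d$. The state space is $\mathcal H=\mathbb R^{d\times N}$ with the norm given by $\|x\|^2=\frac1N\sum_{i=1}^N|x_i|^2$ for $x\in\mathbb R^{d\times N}$, and $\operatorname{dist}_{\mathcal H}$ is the induced distance, $\operatorname{dist}_{\mathcal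 H}(x,y)=\|x-y\|$. Discrete error functional: with the trajectories $x_i=x_i^{[a]}$ of the system with kernel $a$, $$\mathcal E^{[a],N}(\widehat a)=\frac1T\int_0^T\frac1N\sum_{i=1}^N\Bigl|\frac1N\sum_{j=1}^N\widehat a(|x_i(t)-x_j(t)|)(x_j(t)-x_i(t))-\dot x_i(t)\Bigr|^2dt.$$
   Formalization: The constant C depends on T, a and the initial datum, and also on a bound of |â| and on bounds of the Lipschitz constants of â on the intervals [0,r]; a constant independent of â does not exist in general. *)

(* Defs.v *)
From mathcomp Require Import all_boot all_order all_algebra.
From mathcomp Require Import all_classical all_reals all_analysis.

Set Implicit Arguments.
Unset Strict Implicit.
Unset Printing Implicit Defensive.

Import Order.TTheory GRing.Theory Num.Theory.
Import numFieldNormedType.Exports.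

Local Open Scope classical_set_scope.
Local Open Scope ring_scope.

(* A kernel b : R_+ -> R is represented by a function on R of which only the
   values on [0, +oo[ are constrained or used. *)
Definition admissible (R : realType) (b : R -> R) : Prop :=
  [bounded b r | r in `[0, +oo[] /\
  forall K : set R, compact K -> K `<=` `[0, +oo[ ->
    [lipschitz b r | r in K].

(* M bounds the sup norm of b, and L r bounds its Lipschitz constant on [0, r]:
   quantitative data witnessing admissibility (see admissibleP). *)
Definition kernel_bounds (R : realType) (M : R) (L : R -> R) (b : R -> R) :
    Prop :=
  (forall r, 0 <= r -> `|b r| <= M) /\
  (forall r, (L r).-lipschitz_(`[0, r]) b).

Lemma admissibleP (R : realType) (b : R -> R) :
  admissible b <-> exists (M : R) (L : R -> R), kernel_bounds M L b.
Proof.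
split=> [[bB bL]|[M [L [bB bL]]]].
  have [M bM] : exists M : R, forall r, 0 <= r -> `|b r| <= M.
    have /pinfty_ex_gt0[M _ bM] := bB.
    by exists M => r r0; apply: bM; rewrite /= in_itv/= r0.
  have /choice[L HL] (r : R) : exists l : R, l.-lipschitz_(`[0, r]) b.
    have /pinfty_ex_gt0[l _ bl] : [lipschitz b x | x in `[0, r]].
      apply: bL; first exact: segment_compact.
      by move=> x /=; rewrite !in_itv/= => /andP[->].
    by exists l.
  by exists M, L.
split.
  exists M; split; first exact: num_real.
  move=> B /ltW MB r /=; rewrite in_itv/= andbT => r0.
  exact: le_trans (bB _ r0) MB.
move=> K cK K0; have [B [_ /(_ (B + 1))]] := compact_bounded cK.
rewrite ltrDl ltr01 => /(_ isT) KB.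
have K1 x : K x -> x \in `[0, B + 1].
  move=> Kx; have /= := K0 _ Kx; rewrite !in_itv/= andbT => -> /=.
  exact: le_trans (ler_norm _) (KB _ Kx).
exists (L (B + 1)); split; first exact: num_real.
move=> l /ltW Ll [x y] /= [Kx Ky].
have := bL (B + 1) (x, y) (conj (K1 _ Kx) (K1 _ Ky)) => /= /le_trans; apply.
by rewrite ler_wpM2r.
Qed.

(* The library norm on matrices is the maximum norm. *)
Definition enorm (R : realType) (d : nat) (v : 'cV[R]_d) : R :=
  Num.sqrt (\sum_(k < d) v k 0 ^+ 2).

(* A state x of R^{d x N} is a d x N matrix whose i-th column is particle i. *)
Definition normH (R : realType) (d N : nat) (x : 'M[R]_(d, N)) : R :=
  Num.sqrt (N%:R^-1 * \sum_(i < N) enorm (col i x) ^+ 2).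

Definition distH (R : realType) (d N : nat) (x y : 'M[R]_(d, N)) : R :=
  normH (x - y).

(* x solves the particle system with kernel b on [0, T], in the classical sense:
   continuous on [0, T] with the equation holding on ]0, T[, where the two-sided
   derivative does not see the values of x outside [0, T]. Continuity of the
   right-hand side then gives the one-sided equations at 0 and T. *)
Definition particle_solution (R : realType) (d N : nat) (b : R -> R) (T : R)
    (x : R -> 'M[R]_(d, N)) : Prop :=
  {within `[0, T], continuous x} /\
  forall t, t \in `]0, T[ ->
    derivable x t 1 /\
    forall i : 'I_N,
      col i ('D_1 x t) =
      N%:R^-1 *: \sum_(j < N | j != i)
        b (enorm (col i (x t) - col j (x t))) *: (col j (x t) - col i (x t)).

(* The value of 'D_1 x at the end points 0 and T, which depends on how x is
   extended outside [0, T], does not affect the integral. *)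
Definition error_functional (R : realType) (d N : nat) (T : R)
    (x : R -> 'M[R]_(d, N)) (bhat : R -> R) : R :=
  T^-1 * \int[lebesgue_measure]_(t in `[0, T])
    (N%:R^-1 * \sum_(i < N)
       enorm (N%:R^-1 *: (\sum_(j < N)
                bhat (enorm (col i (x t) - col j (x t))) *:
                  (col j (x t) - col i (x t)))
              - col i ('D_1 x t)) ^+ 2).

(* Main.v *)
(* Along xa, the vector (force of kernel ahat) - xa' has mean square e(t), whose
   time average is the error functional. Writing
     xa' - xahat' = (xa' - F_ahat(xa)) + (F_ahat(xa) - F_ahat(xahat)),
   the squared norm g of xa - xahat satisfies g' <= (1 + 4 K) g + e, where K is
   a Lipschitz constant of v |-> ahat(|v|) v on a ball containing all particle
   differences; Gronwall's inequality concludes since g(0) = 0. The same energy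
   estimate with e = 0, applied to each solution separately, bounds the radius
   of that ball in terms of the initial datum and the sup norms of the kernels. *)
Require Import Defs.
From mathcomp Require Import all_boot all_order all_algebra.
From mathcomp Require Import all_classical all_reals all_analysis.
From mathcomp Require Import measurable_realfun ring lra.

Import Order.TTheory GRing.Theory Num.Theory.
Import numFieldNormedType.Exports.

Local Open Scope classical_set_scope.
Local Open Scope ring_scope.

(** * Euclidean inner product and norm on column vectors *)

Section Euclidean.
Context {R : realType} {d : nat}.
Implicit Types u v w : 'cV[R]_d.

Definition dot u v : R := \sum_(k < d) u k 0 * v k 0.

Lemma dotDr u v w : dot u (v + w) = dot u v + dot u w.
Proof.
by rewrite -big_split; apply: eq_bigr => k _; rewrite mxE mulrDr.
Qed.

Lemma dotZr c u v : dot u (c *: v) = c * dot u v.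
Proof. by rewrite mulr_sumr; apply: eq_bigr => k _; rewrite mxE mulrCA. Qed.

Lemma dot_sumr (I : finType) u (F : I -> 'cV[R]_d) :
  dot u (\sum_i F i) = \sum_i dot u (F i).
Proof.
by rewrite exchange_big; apply: eq_bigr => k _; rewrite summxE mulr_sumr.
Qed.

Lemma enorm_ge0 u : 0 <= enorm u.
Proof. exact: sqrtr_ge0. Qed.

Lemma enorm_sqr u : enorm u ^+ 2 = dot u u.
Proof.
by rewrite sqr_sqrtr ?sumr_ge0 // => k _; rewrite sqr_ge0.
Qed.

Lemma enorm_eq0 u : enorm u = 0 -> u = 0.
Proof.
move=> u0; have /eqP : dot u u = 0 by rewrite -enorm_sqr u0 expr0n.
rewrite psumr_eq0 => [/allP uu|k _]; last by rewrite -expr2 sqr_ge0.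
apply/colP => k; rewrite mxE.
by have := uu k (mem_index_enum k); rewrite mulf_eq0 orbb => /eqP.
Qed.

Lemma cauchy_schwarz u v : dot u v <= enorm u * enorm v.
Proof.
have [u0|un0] := eqVneq (enorm u) 0.
  rewrite u0 mul0r (enorm_eq0 _ u0) /dot big1 // => k _.
  by rewrite mxE mul0r.
have [v0|vn0] := eqVneq (enorm v) 0.
  rewrite v0 mulr0 (enorm_eq0 _ v0) /dot big1 // => k _.
  by rewrite mxE mulr0.
have p : 0 < enorm u * enorm v.
  by rewrite mulr_gt0 // lt_neqAle eq_sym ?un0 ?vn0 enorm_ge0.
(* Expanding the square of [enorm v *: u - enorm u *: v] gives twice [p * (p - dot u v)] with [p]
   the product of the norms; the positive factor then cancels. *)
have : 0 <= \sum_(k < d) (enorm v * u k 0 - enorm u * v k 0) ^+ 2.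
  by rewrite sumr_ge0 // => k _; rewrite sqr_ge0.
have -> : \sum_(k < d) (enorm v * u k 0 - enorm u * v k 0) ^+ 2 =
    enorm v ^+ 2 * dot u u + enorm u ^+ 2 * dot v v
    - 2 * (enorm u * enorm v) * dot u v.
  rewrite !mulr_sumr -big_split -sumrB; apply: eq_bigr => k _ /=; ring.
rewrite -!enorm_sqr => h.
rewrite -(ler_pM2l p); nra.
Qed.

Lemma enormD u v : enorm (u + v) <= enorm u + enorm v.
Proof.
rewrite -(@ler_pXn2r _ 2) ?nnegrE ?addr_ge0 ?enorm_ge0 //.
have := cauchy_schwarz u v.
have -> : enorm (u + v) ^+ 2 = dot u u + 2 * dot u v + dot v v.
  rewrite enorm_sqr /dot mulr_sumr -!big_split; apply: eq_bigr => k _ /=.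
  rewrite !mxE; ring.
rewrite -!enorm_sqr; nra.
Qed.

Lemma enormZ c u : enorm (c *: u) = `|c| * enorm u.
Proof.
rewrite -sqrtr_sqr /enorm -sqrtrM ?sqr_ge0 // mulr_sumr; congr Num.sqrt.
by apply: eq_bigr => k _; rewrite mxE exprMn.
Qed.

Lemma enormN u : enorm (- u) = enorm u.
Proof. by rewrite -scaleN1r enormZ normrN1 mul1r. Qed.

Lemma enormB u v : enorm (u - v) <= enorm u + enorm v.
Proof. by rewrite -[enorm v]enormN enormD. Qed.

Lemma ler_dist_enorm u v : `|enorm u - enorm v| <= enorm (u - v).
Proof.
have := enormD (u - v) v; have := enormD (v - u) u.
by rewrite !subrK -[enorm (v - u)]enormN opprB ler_norml => *; lra.
Qed.

End Euclidean.

(** * Forces, defect and the energy estimate *)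

Section Particles.
Context {R : realType} {d N : nat}.
Implicit Types (b : R -> R) (x y z : 'M[R]_(d, N)).

(** The diagonal term is kept, as in the error functional. It carries the zero vector, so this is
    also the right-hand side of the particle system. *)
Definition interaction b x (i : 'I_N) : 'cV[R]_d :=
  N%:R^-1 *: \sum_(j < N)
    b (enorm (col i x - col j x)) *: (col j x - col i x).

(* The mean square difference of the forces of two kernels; with c = a and x
   a solution for a, it is the integrand of the error functional on ]0, T[. *)
Definition defect b c x : R :=
  N%:R^-1 * \sum_(i < N) enorm (interaction b x i - interaction c x i) ^+ 2.

Lemma normH_sqr x : normH x ^+ 2 = N%:R^-1 * \sum_(i < N) enorm (col i x) ^+ 2.
Proof.
rewrite sqr_sqrtr // mulr_ge0 ?invr_ge0 // sumr_ge0 // => i _.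
exact: sqr_ge0.
Qed.

Lemma enorm_col_le x i : enorm (col i x) <= Num.sqrt (N%:R * normH x ^+ 2).
Proof.
have N0 : (0 < N%:R :> R) by rewrite ltr0n (leq_ltn_trans _ (ltn_ord i)).
rewrite -[leLHS]ger0_norm ?enorm_ge0 // -sqrtr_sqr ler_wsqrtr //.
rewrite normH_sqr mulrA mulfV ?gt_eqF // mul1r (bigD1 i) //= lerDl.
by rewrite sumr_ge0 // => j _; exact: sqr_ge0.
Qed.

Lemma interaction_neq b x i :
  interaction b x i = N%:R^-1 *: \sum_(j < N | j != i)
    b (enorm (col i x - col j x)) *: (col j x - col i x).
Proof.
by rewrite /interaction (bigD1 i) //= [X in _ *: X + _]subrr scaler0 add0r.
Qed.

(** Cauchy-Schwarz and Young bound each pair by [K * (3 |z_i|^2 + |z_j|^2)]; averaging over [i] and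
    [j] turns 3 + 1 into the factor 4. Leaving [w] abstract covers both the force along one solution
    and the difference of forces along two. *)
Lemma energy_interaction_le (K : R) z (w : 'I_N -> 'I_N -> 'cV[R]_d) :
  (forall i j, enorm (w i j) <= K * (enorm (col i z) + enorm (col j z))) ->
  0 <= K ->
  N%:R^-1 * (\sum_(i < N) 2 * dot (col i z) (N%:R^-1 *: \sum_(j < N) w i j)) <=
  4 * K * normH z ^+ 2.
Proof.
move=> wK K0.
have ij i j : 2 * dot (col i z) (w i j) <=
    K * (3 * enorm (col i z) ^+ 2 + enorm (col j z) ^+ 2).
  have := cauchy_schwarz (col i z) (w i j).
  have := ler_wpM2l (enorm_ge0 (col i z)) (wK i j).
  have := mulr_ge0 K0 (sqr_ge0 (enorm (col i z) - enorm (col j z))).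
  nra.
rewrite normH_sqr; set S := \sum_(i < N) enorm (col i z) ^+ 2.
have sumK : \sum_(i < N) 2 * dot (col i z) (N%:R^-1 *: \sum_(j < N) w i j) <=
    \sum_(i < N) N%:R^-1 * (K * (3 * (N%:R * enorm (col i z) ^+ 2) + S)).
  apply: ler_sum => i _.
  rewrite dotZr mulrCA ler_wpM2l ?invr_ge0 // dot_sumr mulr_sumr.
  apply: le_trans (ler_sum _ (fun j _ => ij i j)) _.
  by rewrite -mulr_sumr big_split /= sumr_const card_ord -/S -mulr_natl; lra.
(* For [N = 0] the convention [0^-1 = 0] makes both sides vanish. *)
have [N0|N0] := eqVneq (N%:R : R) 0; first by rewrite N0 invr0 !mul0r mulr0.
apply: le_trans (ler_wpM2l _ sumK) _; first by rewrite invr_ge0.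
rewrite -!mulr_sumr big_split /= -!mulr_sumr -/S sumr_const card_ord -mulr_natl.
by rewrite le_eqVlt; apply/orP; left; apply/eqP; field.
Qed.

End Particles.

(** * Gronwall's inequality with a nonnegative source *)

Lemma gronwall {R : realType} (T k : R) (g e : R -> R) :
  0 < T -> 0 <= k -> 0 <= g 0 ->
  {within `[0, T], continuous g} -> {within `[0, T], continuous e} ->
  (forall t : R, t \in `[0, T] -> 0 <= e t) ->
  (forall t : R, t \in `]0, T[ -> derivable g t 1 /\ 'D_1 g t <= k * g t + e t) ->
  forall t : R, t \in `[0, T] ->
    g t <= expR (k * T) * (g 0 + \int[lebesgue_measure]_(s in `[0, T]) e s).
Proof.
move=> T0 k0 g0 cg ce e0 dg t tT.
have ie : lebesgue_measure.-integrable `[0, T] (EFin \o e).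
  by apply: continuous_compact_integrable => //; exact: segment_compact.
pose I (s : R) := \int[lebesgue_measure]_(r in `[0, s]) e r.
have dI (s : R) : s \in `]0, T[ -> derivable I s 1 /\ 'D_1 I s = e s.
  move=> sT; have := sT; rewrite in_itv /= => /andP[s0 s1].
  rewrite -derive1E; apply: (continuous_FTC1_closed s1 ie s0).
  exact: (within_continuous_continuous _ _ sT).
pose E (s : R) : R := expR (- k * s).
have dE (s : R) : is_derive s 1 E (- k * E s).
  rewrite /E; apply: is_derive_eq; rewrite /GRing.scale/=; ring.
(* With the integrating factor [E], the hypothesis gives [phi' = E (g' - k g) - e <= (E - 1) e <= 0]
   on the open interval, since [E <= 1] and [e >= 0] there; hence [phi] does not increase. *)
pose phi (s : R) := E s * g s - I s.
have dphi (s : R) : s \in `]0, T[ ->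
    is_derive s 1 phi (- k * E s * g s + E s * 'D_1 g s - e s).
  move=> sT; have [gd _] := dg _ sT; have [Id Ie] := dI _ sT.
  have gD : is_derive s 1 g ('D_1 g s) by exact: derivableP.
  have ID : is_derive s 1 I (e s).
    by rewrite -Ie; exact: derivableP.
  rewrite /phi; apply: is_derive_eq; rewrite /GRing.scale/=; ring.
have cE : continuous E.
  by move=> s; apply: differentiable_continuous; apply/derivable1_diffP.
have cphi : {within `[0, T], continuous phi}.
  move=> s; apply: cvgB; first apply: cvgM.
  - exact: (continuous_subspaceT cE).
  - exact: cg.
  - exact: (parameterized_integral_continuous (ltW T0) ie).
have tT' := tT; move: tT'; rewrite in_itv /= => /andP[t0 t1].
have phi_le : phi t <= phi 0.
  apply: (@ler0_derive1_le_cc R phi 0 T) => //.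
  - by move=> s /dphi[].
  - move=> s sT; rewrite derive1E; have [_ ->] := dphi _ sT.
    have [_ gs] := dg _ sT.
    have es : 0 <= e s by apply: e0; exact: subset_itv_oo_cc.
    have Es1 : E s <= 1.
      rewrite -expR0 ler_expR; move: sT; rewrite in_itv /= => /andP[s0 _].
      by have := mulr_ge0 k0 (ltW s0); lra.
    have := ler_wpM2l (expR_ge0 (- k * s)) gs; rewrite -/(E s).
    have := ler_wpM2r es Es1; nra.
  - by rewrite in_itv /= lexx ltW.
(* Passing to the integral over the whole interval makes the bound uniform in [t]. *)
have IT : I t <= I T.
  have := Rintegral_itvB (x := t) ie.
  rewrite !bnd_simp => /(_ t0 t1) IB.
  rewrite -subr_ge0 IB Rintegral_ge0 // => s /=.
  rewrite in_itv /= => /andP[ts sT]; apply: e0; rewrite in_itv /= sT andbT.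
  exact: le_trans (ltW ts).
have I00 : I 0 = 0 by rewrite /I set_itv1 Rintegral_set1.
have I0 : 0 <= I T.
  by rewrite /I Rintegral_ge0 // => s sT; apply: e0; exact: sT.
move: phi_le; rewrite /phi /E mulr0 expR0 mul1r I00 subr0 => phi_le.
have : g t <= expR (k * t) * (g 0 + I T).
  have := expR_gt0 (k * t); move: phi_le; rewrite mulNr expRN => + p.
  rewrite lerBlDr ler_pdivrMl // => /le_trans; apply.
  by rewrite ler_pM2l // lerD2l.
move=> /le_trans; apply; rewrite ler_wpM2r ?addr_ge0 //.
by rewrite ler_expR ler_wpM2l.
Qed.

(** * Regularity inherited from the kernel bounds *)

Lemma kernel_bounds_vector_lipschitz {R : realType} {d : nat} (M : R)
    (L : R -> R) (b : R -> R) (rho : R) (u v : 'cV[R]_d) :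
  kernel_bounds M L b -> enorm u <= rho -> enorm v <= rho ->
  enorm (b (enorm u) *: u - b (enorm v) *: v) <=
    (`|M| + `|L rho| * rho) * enorm (u - v).
Proof.
move=> [bM bL] ur vr.
(* The first term is controlled by the sup bound; the second by the Lipschitz constant on [[0, rho]]
   together with [enorm v <= rho]. *)
have -> : b (enorm u) *: u - b (enorm v) *: v =
    b (enorm u) *: (u - v) + (b (enorm u) - b (enorm v)) *: v.
  by rewrite scalerBr scalerBl addrA subrK.
apply: le_trans (enormD _ _) _; rewrite !enormZ mulrDl lerD //.
  by rewrite ler_wpM2r ?enorm_ge0 // (le_trans (bM _ (enorm_ge0 u))) // ler_norm.
rewrite mulrAC ler_pM ?enorm_ge0 //.
have /= := bL rho (enorm u, enorm v); rewrite !in_itv /= !enorm_ge0 /= => bLr.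
apply: le_trans (bLr (conj ur vr)) _.
apply: le_trans (ler_wpM2r _ (ler_norm _)) _; first exact: normr_ge0.
by rewrite ler_wpM2l // ler_dist_enorm.
Qed.

(** The kernel is controlled only on the half-line. Its even extension is continuous on all of [R]
    and agrees with it at every value of [enorm], so it can be composed freely. *)
Lemma kernel_bounds_continuous {R : realType} (M : R) (L : R -> R)
    (b : R -> R) :
  kernel_bounds M L b -> continuous (fun r : R => b `|r|).
Proof.
(* All points within distance 1 of [r] have absolute value at most [q], so one Lipschitz constant
   serves near [r]. *)
move=> [_ bL] r; set q := `|r| + 1.
have q1 s : `|r - s| < 1 -> `|s| <= q.
  by rewrite /q => rs; have := ler_normD (s - r) r; rewrite subrK distrC; lra.
apply/cvgrPdist_lt => e e0; near=> s.
have rs : `|r - s| < 1 by near: s; apply: cvgr_dist_lt.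
have /= := bL q (`|r|, `|s|); rewrite !in_itv /= !normr_ge0 /=.
have rq : `|r| <= q by rewrite lerDl.
move=> /(_ (conj rq (q1 _ rs))) /le_lt_trans; apply.
(* [L q] may be zero or negative; [|L q| + 1] is a positive replacement by which one can divide. *)
apply: (@le_lt_trans _ _ ((`|L q| + 1) * `|r - s|)).
  have := ler_wpM2r (normr_ge0 (`|r| - `|s|)) (ler_norm (L q)).
  have := ler_wpM2l (normr_ge0 (L q)) (ler_dist_dist r s).
  by have := normr_ge0 (r - s); lra.
rewrite -ltr_pdivlMl; last by rewrite ltr_wpDl.
near: s; apply: cvgr_dist_lt => //.
by rewrite mulr_gt0 // invr_gt0 ltr_wpDl.
Unshelve. all: by end_near. Qed.

(** * Continuity and differentiation of functions of the state *)

Section MatrixCalculus.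
Context {R : realType} {d N : nat}.
Implicit Types (b c : R -> R) (x : R -> 'M[R]_(d, N)).

Lemma enorm_sqr_sum (v : 'cV[R]_d) : enorm v ^+ 2 = \sum_(k < d) v k 0 ^+ 2.
Proof. by rewrite enorm_sqr. Qed.

Lemma continuous_sumr {T : topologicalType} {n : nat} (f : 'I_n -> T -> R) :
  (forall i, continuous (f i)) -> continuous (fun s => \sum_(i < n) f i s).
Proof. by move=> fc; apply: continuous_big => //; exact: add_continuous. Qed.

Lemma continuous_mulr {T : topologicalType} (f g : T -> R) :
  continuous f -> continuous g -> continuous (fun s => f s * g s).
Proof. by move=> fc gc s; apply: cvgM; [exact: fc|exact: gc]. Qed.

Lemma continuous_subr {T : topologicalType} (f g : T -> R) :
  continuous f -> continuous g -> continuous (fun s => f s - g s).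
Proof. by move=> fc gc s; apply: cvgB; [exact: fc|exact: gc]. Qed.

Lemma continuous_sqr {T : topologicalType} (f : T -> R) :
  continuous f -> continuous (fun s => f s ^+ 2).
Proof. by move=> fc; exact: (continuous_mulr _ _ fc fc). Qed.

Lemma continuous_enorm {T : topologicalType} (f : T -> 'cV[R]_d) :
  (forall k, continuous (fun s => f s k 0)) -> continuous (fun s => enorm (f s)).
Proof.
move=> fc s.
apply: (@continuous_comp _ _ _ (fun s => \sum_(k < d) f s k 0 ^+ 2) Num.sqrt).
  2: exact: sqrt_continuous.
apply: continuous_sumr => k y; exact: continuous_sqr (fc k) y.
Qed.

Lemma continuous_interaction (M : R) (L : R -> R) b i k :
  kernel_bounds M L b ->
  continuous (fun X : 'M[R]_(d, N) => interaction b X i k 0).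
Proof.
move=> /kernel_bounds_continuous bc.
have coordB j j' k' : continuous (fun X : 'M[R]_(d, N) => X k' j - X k' j').
  by apply: continuous_subr; exact: coord_continuous.
have -> : (fun X : 'M[R]_(d, N) => interaction b X i k 0) =
    (fun X => N%:R^-1 * \sum_(j < N)
      b `|enorm (col i X - col j X)| * (X k j - X k i)).
  apply/funext => X; rewrite !mxE summxE; congr (_ * _); apply: eq_bigr => j _.
  by rewrite !mxE ger0_norm ?enorm_ge0.
apply: continuous_mulr; first exact: cst_continuous.
apply: continuous_sumr => j; apply: continuous_mulr; last exact: coordB.
move=> X; apply: (@continuous_comp _ _ _
  (fun X : 'M[R]_(d, N) => enorm (col i X - col j X)) (fun r => b `|r|)).
  2: exact: bc.
apply: continuous_enorm => k'.
have -> : (fun X : 'M[R]_(d, N) => (col i X - col j X) k' 0) =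
    (fun X => X k' i - X k' j) by apply/funext => Z; rewrite !mxE.
exact: coordB.
Qed.

Lemma continuous_defect (M M' : R) (L L' : R -> R) b c :
  kernel_bounds M L b -> kernel_bounds M' L' c ->
  continuous (defect b c : 'M[R]_(d, N) -> R).
Proof.
move=> kb kc; apply: continuous_mulr; first exact: cst_continuous.
apply: continuous_sumr => i.
apply: continuous_sqr.
apply: continuous_enorm => k.
have -> : (fun X : 'M[R]_(d, N) => (interaction b X i - interaction c X i) k 0)
    = (fun X => interaction b X i k 0 - interaction c X i k 0).
  by apply/funext => Z; rewrite mxE [X in _ + X]mxE.
by apply: continuous_subr;
  [exact: (continuous_interaction _ _ _ _ _ kb)|
   exact: (continuous_interaction _ _ _ _ _ kc)].
Qed.

Lemma normH_sqrE (X : 'M[R]_(d, N)) :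
  normH X ^+ 2 = N%:R^-1 * \sum_(i < N) \sum_(k < d) X k i ^+ 2.
Proof.
rewrite normH_sqr; congr (_ * _); apply: eq_bigr => i _.
by rewrite enorm_sqr_sum; apply: eq_bigr => k _; rewrite mxE.
Qed.

Lemma continuous_normH_sqr :
  continuous (fun X : 'M[R]_(d, N) => normH X ^+ 2).
Proof.
rewrite (funext normH_sqrE).
apply: continuous_mulr; first exact: cst_continuous.
apply: continuous_sumr => i; apply: continuous_sumr => k.
apply: continuous_sqr.
exact: coord_continuous.
Qed.

Lemma is_derive_normH_sqr x (t : R) :
  derivable x t 1 ->
  is_derive t 1 (fun s => normH (x s) ^+ 2)
    (N%:R^-1 * \sum_(i < N) 2 * dot (col i (x t)) (col i ('D_1 x t))).
Proof.
move=> xt; have xd k i : is_derive t 1 (fun s => x s k i) ('D_1 x t k i).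
  apply: DeriveDef; first exact: (derivable_mxP _ _ _).1.
  by rewrite derive_mx // mxE.
rewrite (_ : (fun _ => _) =
    N%:R^-1 *: \sum_(i < N) \sum_(k < d) (fun s => x s k i) ^+ 2); last first.
  apply/funext => s; rewrite normH_sqrE [RHS]/= -[RHS]/(_ * _) fct_sumE.
  congr (_ * _); apply: eq_bigr => i _; rewrite fct_sumE; exact: eq_bigr.
have Xd k i : is_derive t 1 ((fun s => x s k i) ^+ 2)
    (2 * (x t k i * 'D_1 x t k i)).
  apply: is_derive_eq.
  by rewrite /GRing.scale /= expr1; ring.
apply: is_deriveZ; apply: is_derive_sum => i.
rewrite mulr_sumr (eq_bigr (fun k => 2 * (x t k i * 'D_1 x t k i))) => [|k _].
  by apply: is_derive_sum => k.
by rewrite !mxE.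
Qed.

End MatrixCalculus.

(** * A priori bound and error functional along solutions *)

Section Solutions.
Context {R : realType} {d N : nat}.
Implicit Types (a b c : R -> R) (x y : R -> 'M[R]_(d, N)).

Lemma particle_solution_derive b (T : R) x (t : R) (i : 'I_N) :
  particle_solution b T x -> t \in `]0, T[ ->
  col i ('D_1 x t) = interaction b (x t) i.
Proof. by move=> [_ bx] /bx[_ ->]; rewrite interaction_neq. Qed.

Lemma within_continuous_comp_mx (A : set R) x (f : 'M[R]_(d, N) -> R) :
  {within A, continuous x} -> continuous f ->
  {within A, continuous (fun t => f (x t))}.
Proof. by move=> xc fc t; apply: continuous_comp; [exact: xc|exact: fc]. Qed.

(** Each pair force is at most [B (|x_i| + |x_j|)], so the squared norm grows at rate at most
    [4 * B], and Gronwall applies with zero source. *)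
Lemma particle_solution_bound b (B T : R) x (t : R) :
  0 <= B -> (forall r, 0 <= r -> `|b r| <= B) -> 0 < T ->
  particle_solution b T x -> t \in `[0, T] ->
  normH (x t) ^+ 2 <= expR (4 * B * T) * normH (x 0) ^+ 2.
Proof.
move=> B0 bB T0 bx tT; have [xc xd] := bx.
have := @gronwall R T (4 * B) (fun s => normH (x s) ^+ 2) (cst 0) T0.
have -> : \int[lebesgue_measure]_(s in `[0, T]) (cst 0 s : R) = 0.
  by rewrite /Rintegral integral0_eq.
rewrite addr0; apply => //.
- by rewrite mulr_ge0.
- exact: sqr_ge0.
- exact: (within_continuous_comp_mx _ _ _ xc continuous_normH_sqr).
- by apply: continuous_subspaceT => s; exact: cst_continuous.
- move=> s sT; have [xds _] := xd _ sT.
  have [gd ->] := is_derive_normH_sqr _ _ xds.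
  split => //; rewrite addr0.
  under eq_bigr do rewrite (particle_solution_derive _ _ _ _ _ bx sT).
  apply: energy_interaction_le => // i j; rewrite enormZ.
  apply: ler_pM; rewrite ?enorm_ge0 //; first exact/bB/enorm_ge0.
  by rewrite [leRHS]addrC; exact: enormB.
Qed.

(** On the open interval the equation replaces the derivative by the force of [a]; the two end
    points are a null set. *)
Lemma error_functionalE a c (T : R) x :
  0 < T -> particle_solution a T x ->
  {within `[0, T], continuous (fun t => defect c a (x t))} ->
  T * error_functional T x c =
  \int[lebesgue_measure]_(t in `[0, T]) defect c a (x t).
Proof.
move=> T0 ax cd; rewrite /error_functional mulrA mulfV ?gt_eqF // mul1r.
have md : measurable_fun `]0, T[ (fun t => defect c a (x t)).
  apply: (@measurable_funS _ _ _ _ `[0, T]) => //.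
    exact: subset_itv_oo_cc.
  exact: subspace_continuous_measurable_fun.
have eqd : {in `]0, T[, (fun t => defect c a (x t)) =1 (fun t =>
    N%:R^-1 * \sum_(i < N) enorm (N%:R^-1 *: (\sum_(j < N)
      c (enorm (col i (x t) - col j (x t))) *: (col j (x t) - col i (x t)))
      - col i ('D_1 x t)) ^+ 2)}.
  move=> t tT; rewrite /defect; congr (_ * _); apply: eq_bigr => i _.
  by rewrite (particle_solution_derive _ _ _ _ _ ax tT).
rewrite /Rintegral; congr fine; apply/esym/eq_integral_itv_bounded => //.
apply: eq_measurable_fun md => t; rewrite inE; exact: eqd.
Qed.

End Solutions.

(** * The stability estimate *)

Theorem proposition1p1 (R : realType) (d N : nat) (T : R) (a : R -> R)
    (x0 : 'M[R]_(d, N)) :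
  0 < T -> admissible a ->
  (* C depends on ahat only through its bounds (M, L); every admissible ahat
     has such bounds, see admissibleP *)
  forall (M : R) (L : R -> R),
  exists2 C : R, 0 < C &
    forall ahat : R -> R, admissible ahat -> kernel_bounds M L ahat ->
    forall xa xahat : R -> 'M[R]_(d, N),
      particle_solution a T xa -> particle_solution ahat T xahat ->
      xa 0 = x0 -> xahat 0 = x0 ->
    forall t, t \in `[0, T] ->
      distH (xa t) (xahat t) ^+ 2 = normH (xa t - xahat t) ^+ 2 /\
      normH (xa t - xahat t) ^+ 2 <= C * error_functional T xa ahat.
Proof.
move=> T0 /admissibleP[A [La ka]] M L.
(* [B] bounds both kernels, so a single radius works for both solutions: the square root in [rho]
   bounds every particle norm, and the factor 2 passes to differences of particles. *)
pose B := `|A| + `|M|.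
pose rho := 2 * Num.sqrt (N%:R * (expR (4 * B * T) * normH x0 ^+ 2)).
pose K := `|M| + `|L rho| * rho.
have B0 : 0 <= B by rewrite addr_ge0.
have rho0 : 0 <= rho by rewrite mulr_ge0 // sqrtr_ge0.
have K0 : 0 <= K by rewrite addr_ge0 // mulr_ge0.
(* The leading [T] cancels the time average in the error functional; the exponential is the Gronwall
   factor. *)
exists (T * expR ((4 * K + 1) * T)); first by rewrite mulr_gt0 // expR_gt0.
move=> ahat _ kh x y ax hy xx0 yx0 t tT; split => //.
have [xc xd] := ax; have [yc yd] := hy.
have aB r : 0 <= r -> `|a r| <= B.
  move=> /(proj1 ka r) /le_trans; apply.
  by rewrite (le_trans (ler_norm A)) // lerDl.
have hB r : 0 <= r -> `|ahat r| <= B.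
  move=> /(proj1 kh r) /le_trans; apply.
  by rewrite (le_trans (ler_norm M)) // lerDr.
have diam b z s : (forall r, 0 <= r -> `|b r| <= B) -> particle_solution b T z ->
    z 0 = x0 -> s \in `[0, T] ->
    forall i j, enorm (col j (z s) - col i (z s)) <= rho.
  move=> bB bz z0 sT i j.
  have zb := particle_solution_bound _ _ _ _ _ B0 bB T0 bz sT.
  have ci k : enorm (col k (z s)) <=
      Num.sqrt (N%:R * (expR (4 * B * T) * normH x0 ^+ 2)).
    apply: le_trans (enorm_col_le _ _) _; rewrite ler_wsqrtr // ler_wpM2l //.
    by rewrite -z0.
  by rewrite /rho mulr2n mulrDl mul1r (le_trans (enormB _ _)) // lerD.
have cdef : {within `[0, T], continuous (fun s => defect ahat a (x s))}.
  apply: (within_continuous_comp_mx _ _ _ xc).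
  exact: (continuous_defect _ _ _ _ _ _ kh ka).
rewrite (mulrC T) -mulrA (error_functionalE _ _ _ _ T0 ax cdef).
have := @gronwall R T (4 * K + 1) (fun s => normH (x s - y s) ^+ 2)
  (fun s => defect ahat a (x s)) T0.
rewrite xx0 yx0 subrr.
have -> : normH (0 : 'M[R]_(d, N)) ^+ 2 = 0.
  by rewrite normH_sqrE big1 ?mulr0 // => i _; rewrite big1 // => k _;
    rewrite mxE expr0n.
rewrite add0r; apply => //.
- by rewrite addr_ge0 // mulr_ge0.
- have zc : {within `[0, T], continuous (x - y)}.
    by move=> s; apply: cvgB; [exact: xc|exact: yc].
  exact: (within_continuous_comp_mx _ _ _ zc continuous_normH_sqr).
- by move=> s _; rewrite mulr_ge0 ?invr_ge0 // sumr_ge0 // => i _; exact: sqr_ge0.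
move=> s sT; have [xds _] := xd _ sT; have [yds _] := yd _ sT.
have sT' : s \in `[0, T] by exact: subset_itv_oo_cc.
have [gd ->] := is_derive_normH_sqr (x - y) s (derivableB xds yds).
split => //; rewrite deriveB //.
set z := x s - y s.
pose f i := interaction ahat (x s) i - interaction a (x s) i.
pose w i j :=
  ahat (enorm (col j (x s) - col i (x s))) *: (col j (x s) - col i (x s))
  - ahat (enorm (col j (y s) - col i (y s))) *: (col j (y s) - col i (y s)).
(* Adding and subtracting the force of [ahat] at [x s] separates the kernel error [f] from the
   trajectory error [w]. *)
have colB i : col i ('D_1 x s - 'D_1 y s) =
    - f i + N%:R^-1 *: \sum_j w i j.
  rewrite /f linearB /= (particle_solution_derive _ _ _ _ _ ax sT).
  rewrite (particle_solution_derive _ _ _ _ _ hy sT) /w sumrB scalerBr.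
  have E X : N%:R^-1 *: (\sum_(j < N)
      ahat (enorm (col j X - col i X)) *: (col j X - col i X)) =
      interaction ahat X i.
    rewrite /interaction; congr (_ *: _); apply: eq_bigr => j _.
    by rewrite -[enorm (col i X - _)]enormN opprB.
  by rewrite !E opprB addrA subrK.
have wK i j : enorm (w i j) <= K * (enorm (col i z) + enorm (col j z)).
  have := kernel_bounds_vector_lipschitz _ _ _ _ _ _ kh
    (diam _ _ _ aB ax xx0 sT' i j) (diam _ _ _ hB hy yx0 sT' i j).
  move=> /le_trans; apply.
  rewrite ler_wpM2l //.
  have -> : col j (x s) - col i (x s) - (col j (y s) - col i (y s)) =
      col j z - col i z by apply/colP => k; rewrite !mxE; ring.
  by rewrite [leRHS]addrC; exact: enormB.
have := energy_interaction_le _ _ _ wK K0.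
(* Young's inequality [2 |z_i| |f_i| <= |z_i|^2 + |f_i|^2] yields the 1 in the rate [4 * K + 1] and
   the source term [defect]. *)
have : N%:R^-1 * (\sum_(i < N) 2 * dot (col i z) (- f i)) <=
    normH z ^+ 2 + defect ahat a (x s).
  rewrite normH_sqr /defect -mulrDr ler_wpM2l ?invr_ge0 // -big_split.
  apply: ler_sum => i _ /=; rewrite -/(f i).
  have := cauchy_schwarz (col i z) (- f i); rewrite enormN.
  by have := sqr_ge0 (enorm (col i z) - enorm (f i)); nra.
have -> : \sum_(i < N) 2 * dot (col i z) (col i ('D_1 x s - 'D_1 y s)) =
  \sum_(i < N) 2 * dot (col i z) (- f i) +
  \sum_(i < N) 2 * dot (col i z) (N%:R^-1 *: \sum_j w i j).
  by rewrite -big_split; apply: eq_bigr => i _; rewrite colB dotDr mulrDr.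
rewrite mulrDr; lra.
Qed.
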